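(* Let $n\ge1$ and let $\Omega_1,\dots,\Omega_n$ be the $2$-cocycles on the Lie algebroid $\mathrm{BVect}_n(S^1)$ given, for vector fields $u\,\partial_x,v\,\partial_x$ with breaks at $p_1,\dots,p_n$, by $$\Omega_i(u\,\partial_x,v\,\partial_x)=\int_{p_i}^{p_{i+1}}\bigl(u_xv_{xx}-u_{xx}v_x\bigr)\,dx .$$ Then the cocycle $\sum_{i=1}^n c_i\Omega_i$ is not a coboundary for any nonzero vector $c=(c_1,\dots,c_n)\in\mathbb R^n$. Equivalently, $\sum_i c_i\Omega_i$ defines a nontrivial one-dimensional central extension for any $c\neq0$.
   Context: Base. $S^1=\mathbb R/\mathbb Z$ with coordinate $x$; $B\subset (S^1)^n$ is the manifold of $n$-tuples $p=(p_1,\dots,p_n)$ of distinct cyclically ordered points of $S^1$; $p_{n+1}:=p_1$. $[p_i,p_{i+1}]$ is the positively oriented arc from $p_i$ to $p_{i+1}$ (for $n=1$, the whole circle cut at $p_1$), and integrals over it use the one-sided derivatives at its ends. Broken vector fields. A vector field with breaks at $p_1,\dots,p_n$ is a continuous vector field $u(x)\partial_x$ on $S^1$ which on each arc $[p_i,p_{i+1}]$ is smooth up to the boundary (smooth on $S^1\setminus\{p_1,\dots,p_n\}$, with one-sided derivatives of all orders at each $p_i$). $\mathrm{BVect}_n(S^1)$ is the vector bundle over $B$ whose fiber over $p$ is the space of vector fields with breaks at $p_1,\dots,p_n$. A smooth section is a family $\mathbf u=u(x,p)\partial_x$ with $u$ continuous on $S^1\times B$ and smooth up to the boundary on each connected component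 of the complement of the hypersurfaces $\{x=p_i\}$ (i.e. smooth on the manifold with boundary obtained by cutting $S^1\times B$ along these hypersurfaces). Lie algebroid structure. The anchor sends $\mathbf u$ to the vector field $\#\mathbf u=\sum_{i=1}^n u(p_i,p)\,\partial_{p_i}$ on $B$. The bracket of sections $\mathbf u=u(x,p)\partial_x$, $\mathbf v=v(x,p)\partial_x$ is $$[\![\mathbf u,\mathbf v]\!]=\bigl(u v_x-v u_x\bigr)\partial_x+\sum_{i=1}^n\bigl(u(p_i,p)\,v_{p_i}(x,p)-v(p_i,p)\,u_{p_i}(x,p)\bigr)\partial_x ,$$ subscripts denoting partial derivatives. $L_{X}f$ denotes the derivative of a function $f$ on $B$ along a vector field $X$ on $B$. Forms and extensions. A $1$-form (resp. $2$-form) on the algebroid is a fiberwise linear functional (resp. fiberwise skew-symmetric bilinear form) taking smooth sections to smooth functions on $B$. A $2$-form $\Omega$ is a $2$-cocycle if the cyclic sum of $L_{\#\mathbf u}(\Omega(\mathbf v,\mathbf w))-\Omega([\![\mathbf u,\mathbf v]\!],\mathbf w)$ vanishes for all smooth sections; it is a coboundary if there is a $1$-form $\Theta$ with $\Omega(\mathbf u,\mathbf v)=L_{\#\mathbf u}\Theta(\mathbf v)-L_{\#\mathbf v}\Theta(\mathbf u)-\Theta([\![\mathbf u,\mathbf v]\!])$. The one-dimensional central extension defined by a cocycle $\Omega$ is the direct sum with the trivial line bundle, with anchor $\#(\mathbf u,f)=\#\mathbf u$ and bracket $[(\mathbf u,f),(\mathbf v,g)]=([\![\mathbf u,\mathbf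 v]\!],\Omega(\mathbf u,\mathbf v)+L_{\#\mathbf u}g-L_{\#\mathbf v}f)$; it is called trivial if $\Omega$ is a coboundary. *)

(* Defs.v *)
From HB Require Import structures.
From mathcomp Require Import all_boot all_order all_algebra.
From mathcomp Require Import all_classical all_reals all_analysis.

Set Implicit Arguments.
Unset Strict Implicit.
Unset Printing Implicit Defensive.

Import Order.TTheory GRing.Theory Num.Theory.
Import numFieldNormedType.Exports.

Local Open Scope classical_set_scope.
Local Open Scope ring_scope.

(* [Ck_upto O D k f]: all partial derivatives of f of order at most k exist on
   the open set O and extend continuously to D, where O `<=` D `<=` closure O.
   With D = O this is C^k on O. *)
Fixpoint Ck_upto (R : realType) (V : normedModType R) (O D : set V) (k : nat)
    (f : V -> R) : Prop :=
  {within D, continuous f} /\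
  if k is k'.+1 then
    forall v : V, exists g : V -> R,
      (forall z, O z -> is_derive z v f (g z)) /\ Ck_upto O D k' g
  else True.

Definition smooth_upto (R : realType) (V : normedModType R) (O D : set V)
    (f : V -> R) : Prop :=
  forall k, Ck_upto O D k f.

Definition smooth_on (R : realType) (V : normedModType R) (O : set V)
    (f : V -> R) : Prop :=
  smooth_upto O O f.

Section BrokenFields.
Variables (R : realType) (n : nat).

(* Functions on the circle R/Z are 1-periodic functions on R.  A cyclically
   ordered tuple of distinct points of R/Z lifts to real numbers
   p_0 < p_1 < ... < p_(n-1) < p_0 + 1, uniquely up to a simultaneous integer
   translation; functions on B are functions of such lifts that are invariant
   under p |-> p + (1, ..., 1). *)

(* The end p_(i+1) of the i-th arc; it is p_0 + 1 for the last arc. *)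
Definition arc_end (p : 'rV[R]_n) (i : 'I_n) : R :=
  p ord0 (ordS i) + (i.+1 == n)%:R.

Definition base : set 'rV[R]_n :=
  [set p : 'rV[R]_n | forall i, p ord0 i < arc_end p i].

Definition base_invariant (T : Type) (f : 'rV[R]_n -> T) : Prop :=
  forall p : 'rV[R]_n, base p -> f (p + const_mx 1) = f p.

(* The fiber of BVect_n over p. *)
Definition broken_field (p : 'rV[R]_n) (u : R -> R) : Prop :=
  [/\ forall x, u (x + 1) = u x,
      continuous u
    & forall i, smooth_upto `]p ord0 i, arc_end p i[ `[p ord0 i, arc_end p i] u].

(* The components of the circle bundle over B cut along the hypersurfaces
   x = p_i: interior, and with the boundary added. *)
Definition cut_open (i : 'I_n) : set (R * 'rV[R]_n) :=
  [set z | base z.2 /\ z.2 ord0 i < z.1 < arc_end z.2 i].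

Definition cut_closed (i : 'I_n) : set (R * 'rV[R]_n) :=
  [set z | base z.2 /\ z.2 ord0 i <= z.1 <= arc_end z.2 i].

Definition smooth_section (u : R * 'rV[R]_n -> R) : Prop :=
  [/\ forall x p, base p -> u (x + 1, p) = u (x, p),
      forall x, base_invariant (fun p => u (x, p)),
      {within [set z | base z.2], continuous u}
    & forall i, smooth_upto (cut_open i) (cut_closed i) u].

Definition at_fiber (u : R * 'rV[R]_n -> R) (p : 'rV[R]_n) : R -> R :=
  fun x => u (x, p).

Definition anchor (u : R * 'rV[R]_n -> R) (p : 'rV[R]_n) : 'rV[R]_n :=
  \row_i u (p ord0 i, p).

Definition partial_x (u : R * 'rV[R]_n -> R) (z : R * 'rV[R]_n) : R :=
  'D_((1, 0) : R * 'rV[R]_n) u z.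

Definition partial_p (i : 'I_n) (u : R * 'rV[R]_n -> R) (z : R * 'rV[R]_n) : R :=
  'D_((0, delta_mx ord0 i) : R * 'rV[R]_n) u z.

Definition bracket_off_breaks (u v : R * 'rV[R]_n -> R) (z : R * 'rV[R]_n) : R :=
  u z * partial_x v z - v z * partial_x u z +
  \sum_i (u (z.2 ord0 i, z.2) * partial_p i v z -
          v (z.2 ord0 i, z.2) * partial_p i u z).

(* At x = p_i the two-sided partial derivatives need not exist, but the jumps
   of the formula cancel and the bracket is its continuous extension.  Away
   from the breaks the formula is continuous in x and the limit is its value. *)
Definition bracket (u v : R * 'rV[R]_n -> R) (z : R * 'rV[R]_n) : R :=
  lim (bracket_off_breaks u v (y, z.2) @[y --> z.1^'+]).

(* The derivative of f along the vector field X. *)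
Definition lie_derivative (X : 'rV[R]_n -> 'rV[R]_n) (f : 'rV[R]_n -> R)
    (p : 'rV[R]_n) : R :=
  'D_(X p) f p.

Definition one_form (Theta : 'rV[R]_n -> (R -> R) -> R) : Prop :=
  [/\ forall p (a : R) f g, base p -> broken_field p f -> broken_field p g ->
        Theta p (fun x => a * f x + g x) = a * Theta p f + Theta p g,
      forall p f, base p -> broken_field p f ->
        Theta (p + const_mx 1) f = Theta p f
    & forall u, smooth_section u ->
        smooth_on base (fun p => Theta p (at_fiber u p))].

Definition coboundary (Omega : 'rV[R]_n -> (R -> R) -> (R -> R) -> R) : Prop :=
  exists2 Theta, one_form Theta &
    forall u v, smooth_section u -> smooth_section v ->
    forall p, base p ->
      Omega p (at_fiber u p) (at_fiber v p) =
        lie_derivative (anchor u) (fun q => Theta q (at_fiber v q)) p -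
        lie_derivative (anchor v) (fun q => Theta q (at_fiber u q)) p -
        Theta p (at_fiber (bracket u v) p).

(* The ends of the arc are null, so the one-sided derivatives there do not
   enter. *)
Definition arc_cocycle (i : 'I_n) (p : 'rV[R]_n) (u v : R -> R) : R :=
  \int[lebesgue_measure]_(x in `]p ord0 i, arc_end p i[)
    (derive1 u x * derive1n 2 v x - derive1n 2 u x * derive1 v x).

End BrokenFields.

(* Main.v *)
Require Import Defs.
From HB Require Import structures.
From mathcomp Require Import all_boot all_order all_algebra.
From mathcomp Require Import all_classical all_reals all_analysis.
From mathcomp Require Import ring lra zify.

Set Implicit Arguments.
Unset Strict Implicit.
Unset Printing Implicit Defensive.

Import Order.TTheory GRing.Theory Num.Theory.
Import numFieldNormedType.Exports.

Local Open Scope classical_set_scope.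
Local Open Scope ring_scope.

(** Vertical sections, those vanishing at every break, have zero anchor.  If the
cocycle [Omega] were the coboundary of [Theta], then
[Omega u v = - Theta [u, v]] for all vertical [u] and [v], so [Omega] would
take equal values on two vertical pairs with equal brackets.  The proof exhibits
two pairs with equal brackets and different values of [Omega].

For functions [f] and [w] of one variable, the fields [f w^k] satisfy
[[f, f w^3] = 3 [f w, f w^2]] (the relation of the fields x^k d/dx), whereas
the integrand [I(u, v) = u' v'' - u'' v'] satisfies, pointwise,
[I(f, f w^3) - 3 I(f w, f w^2) = - 6 f^2 w'^3].  No integration by parts is
needed: the defect has a sign as soon as [w] is monotone.

Let [i] be an index with [c_i <> 0].  Put [s = sin (pi (x - p_i))] and
[co = cos (pi (x - p_i))], and let [m = max (0, - s sin (pi (x - p_(i+1))))].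
The function [m] is 1-periodic, continuous, positive inside the [i]-th arc, and
zero on all others.  Taking [w = cot (pi (x - p_i))] and [f = m s^4] gives
[f w^k = m s^(4-k) co^k]; for [k <= 3] these are smooth sections supported on
the [i]-th arc ([smooth_arc_section]) and vanishing at all breaks
([arc_section_break]).  The scalar 3 is absorbed in one of the fields, so
that the brackets agree as functions ([arc_section_brackets]) and neither the
linearity nor the smoothness of [Theta] matters.  The defect on the [i]-th arc
is [6 pi^3 m^2 s^2 > 0] ([smooth_arc_field_derivatives]), which makes the two
integrals differ ([arc_cocycle_same]); the other arcs contribute nothing
([arc_cocycle_other]). *)

(** * Trigonometric polynomials *)

Section TrigPoly.
Variables (R : realType) (V : normedModType R).

(** Continuous functions that are affine along every line, with a slope that
depends on the direction only. *)
Definition affine_form (l : V -> R) : Prop :=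
  continuous l /\
  forall v, exists a, forall z (h : R), l (h *: v + z) = h * a + l z.

Lemma is_derive_comp_affine (g : R -> R) (l : V -> R) (z v : V) (a dg : R) :
  (forall z h, l (h *: v + z) = h * a + l z) ->
  is_derive (l z) 1 g dg -> is_derive z v (g \o l) (a * dg).
Proof.
move=> la gdg.
have dfg : differentiable g (l z) by apply/derivable1_diffP; exact: ex_derive.
have dirE : (fun h : R => h^-1 *: (((g \o l) \o shift z) (h *: v) - (g \o l) z)) =
            (fun h : R => h^-1 *: ((g \o shift (l z)) (h *: a) - g (l z))).
  by apply/funext => h /=; rewrite la.
split; rewrite /derivable /derive dirE.
  exact: (diff_derivable (v := a) dfg).
rewrite -/(derive g (l z) a) deriveE // -[a in LHS]mulr1 -[a * 1]/(a *: (1 : R)).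
by rewrite linearZ -deriveE // derive_val.
Qed.

(** Trigonometric polynomials: the algebra of functions generated by the sines
and cosines of affine forms.  It is stable under directional derivatives, so its
members are smooth. *)
Inductive trig_poly : (V -> R) -> Prop :=
| trig_cst a : trig_poly (cst a)
| trig_sin l : affine_form l -> trig_poly (@sin R \o l)
| trig_cos l : affine_form l -> trig_poly (@cos R \o l)
| trig_add f g : trig_poly f -> trig_poly g -> trig_poly (f + g)
| trig_mul f g : trig_poly f -> trig_poly g -> trig_poly (f * g).

Lemma trig_poly_continuous f : trig_poly f -> continuous f.
Proof.
elim=> [a|l [lc _]|l [lc _]|{}f g _ fc _ gc|{}f g _ fc _ gc] z.
- exact: cst_continuous.
- by apply: continuous_comp; [exact: lc|exact: continuous_sin].
- by apply: continuous_comp; [exact: lc|exact: continuous_cos].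
- exact: continuousD (fc z) (gc z).
- exact: continuousM (fc z) (gc z).
Qed.

Lemma trig_poly_derive f v : trig_poly f ->
  exists2 g, trig_poly g & forall z, is_derive z v f (g z).
Proof.
elim=> [a|l lP|l lP|{}f g fT [f' f'T ff'] gT [g' g'T gg']
      |{}f g fT [f' f'T ff'] gT [g' g'T gg']].
- by exists (cst 0); [exact: trig_cst|move=> z; exact: is_derive_cst].
- have [a la] := lP.2 v.
  exists (cst a * (@cos R \o l)); first exact: trig_mul (trig_cst _) (trig_cos lP).
  by move=> z; exact: is_derive_comp_affine la (is_derive_sin _).
- have [a la] := lP.2 v.
  exists (cst (- a) * (@sin R \o l)); first exact: trig_mul (trig_cst _) (trig_sin lP).
  move=> z; apply: (is_derive_eq (is_derive_comp_affine (z := z) la (is_derive_cos _))).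
  by rewrite !fctE /= mulrN mulNr.
- exists (f' + g'); first exact: trig_add.
  by move=> z; exact: is_deriveD.
- exists (f * g' + g * f'); first by apply: trig_add; exact: trig_mul.
  by move=> z; exact: is_deriveM.
Qed.

(** Only the restriction of [f] to [D] matters: a partial derivative at a point
of the open set [O] is computed from nearby points of [O], which lie in [D]. *)
Lemma smooth_upto_trig_poly (O D : set V) f g : open O -> O `<=` D ->
  trig_poly g -> {in D, f =1 g} -> smooth_upto O D f.
Proof.
move=> oO OD + + k.
elim: k f g => [|k IH] f g gT fg; split=> //.
- apply: (@subspace_eq_continuous _ _ _ g).
    by move=> z Dz; apply/esym/fg.
  exact/continuous_subspaceT/trig_poly_continuous.
- apply: (@subspace_eq_continuous _ _ _ g).
    by move=> z Dz; apply/esym/fg.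
  exact/continuous_subspaceT/trig_poly_continuous.
- move=> v; have [g' g'T gg'] := trig_poly_derive v gT.
  exists g'; split; last exact: IH g'T _.
  move=> z Oz; apply: near_eq_is_derive (gg' z).
  have := open_nbhs_nbhs (conj oO Oz); apply: filterS => y Oy.
  by rewrite fg //; apply/mem_set/OD.
Qed.

End TrigPoly.

Lemma trig_poly_exp (R : realType) (V : normedModType R) (f : V -> R) k :
  trig_poly f -> trig_poly (fun z => f z ^+ k).
Proof.
move=> fT; elim: k => [|k IH]; first exact: (@trig_cst _ V 1).
rewrite (_ : (fun z => _) = f * (fun z => f z ^+ k)); first exact: trig_mul.
by apply/funext => z; rewrite exprS.
Qed.

(** * The cyclic order of the breaks *)

Section BaseOrder.
Variables (R : realType) (n : nat).
Implicit Types (p : 'rV[R]_n) (i j : 'I_n).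

Lemma arc_end_inner p i (h : (i.+1 < n)%N) : arc_end p i = p ord0 (Ordinal h).
Proof.
rewrite /arc_end ltn_eqF // addr0; congr (p _ _).
by apply/val_inj; rewrite /= modn_small.
Qed.

Lemma arc_end_last p i j : i.+1 = n -> j = 0%N :> nat ->
  arc_end p i = p ord0 j + 1.
Proof.
move=> hi hj; rewrite /arc_end hi eqxx; congr (p _ _ + _).
by apply/val_inj; rewrite /= hi modnn.
Qed.

Lemma base_homo p i j : base p -> (i <= j)%N -> p ord0 i <= p ord0 j.
Proof.
move=> bp; case: j => m; elim: m => [|m IH] hm /= im.
  by rewrite (_ : i = Ordinal hm) //; apply/val_inj/eqP; rewrite -leqn0.
have [im'|im'] := eqVneq (i : nat) m.+1.
  by rewrite (_ : i = Ordinal hm) //; apply/val_inj.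
have hm' : (m < n)%N := ltnW hm.
apply: le_trans (IH hm' _) _; first by rewrite -ltnS ltn_neqAle im' im.
by rewrite ltW // -(@arc_end_inner p (Ordinal hm')).
Qed.

Lemma arc_end_le p i j : base p -> (i < j)%N -> arc_end p i <= p ord0 j.
Proof.
move=> bp ij; have h : (i.+1 < n)%N := leq_ltn_trans ij (ltn_ord j).
by rewrite (arc_end_inner _ h); exact: base_homo.
Qed.

(** Every arc ends within one turn after every break. *)
Lemma arc_end_leD1 p i j : base p -> arc_end p i <= p ord0 j + 1.
Proof.
move=> bp; have n0 : (0 < n)%N := leq_ltn_trans (leq0n _) (ltn_ord i).
have p0j : p ord0 (Ordinal n0) + 1 <= p ord0 j + 1 by rewrite lerD2r base_homo.
apply: le_trans p0j.
have hl : (n.-1 < n)%N by rewrite prednK.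
have lastE : arc_end p (Ordinal hl) = p ord0 (Ordinal n0) + 1.
  by apply: arc_end_last; rewrite //= prednK.
rewrite -lastE; have [h|] := ltnP i.+1 n.
  by rewrite (arc_end_inner _ h) (le_trans _ (ltW (bp _))) // base_homo //=; lia.
move=> ni; rewrite (_ : i = Ordinal hl) //; apply/val_inj => /=.
by have := ltn_ord i; lia.
Qed.

Lemma arc_end_shift p i : arc_end (p + const_mx 1) i = arc_end p i + 1.
Proof. by rewrite /arc_end !mxE addrAC. Qed.

Lemma coord_cvg (i : 'I_n) : continuous (fun p : 'rV[R]_n => p ord0 i : R).
Proof. exact: coord_continuous. Qed.

Lemma arc_end_continuous i : continuous (fun p : 'rV[R]_n => arc_end p i).
Proof.
move=> p; apply: (@continuousD _ _ _ (fun p => p ord0 (ordS i)) (cst _)).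
  exact: coord_cvg.
exact: cst_continuous.
Qed.

Lemma continuous_comp_snd (f : 'rV[R]_n -> R) :
  continuous f -> continuous (fun z : R * 'rV[R]_n => f z.2).
Proof.
move=> fc z; apply: (@continuous_comp _ _ _ (@snd R 'rV[R]_n) f).
  exact: cvg_snd.
exact: fc.
Qed.

Lemma cut_open_open i : open (@cut_open R n i).
Proof.
rewrite openE => -[x p] [/= bp /andP[px xe]].
have near_lt (f g : R * 'rV[R]_n -> R) : continuous f -> continuous g ->
    f (x, p) < g (x, p) -> \forall z \near (x, p), f z < g z.
  move=> fc gc fg.
  have dc : {for (x, p), continuous (g - f)} by apply: continuousB; [exact: gc|exact: fc].
  have d0 : 0 < (g - f) (x, p) by rewrite !fctE subr_gt0.
  have H := @cvgr_gt _ _ _ (nbhs_filter _) _ _ dc _ d0.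
  by apply: filterS H => z; rewrite !fctE subr_gt0.
have fstc : continuous (fun z : R * 'rV[R]_n => z.1) by move=> z; exact: cvg_fst.
have pc j : continuous (fun z : R * 'rV[R]_n => z.2 ord0 j).
  exact: continuous_comp_snd (@coord_cvg j).
have ec j : continuous (fun z : R * 'rV[R]_n => arc_end z.2 j).
  exact: continuous_comp_snd (@arc_end_continuous j).
have nb : \forall z \near (x, p), forall j, (z : R * 'rV[R]_n).2 ord0 j < arc_end z.2 j.
  apply: (@filter_forall _ _ _ _ (nbhs_filter (x, p))) => j.
  exact: near_lt (pc j) (ec j) (bp j).
have H1 := near_lt _ _ (pc i) fstc px; have H2 := near_lt _ _ fstc (ec i) xe.
apply: (@filterS3 _ _ (nbhs_filter (x, p)) _ _ _ _ _ nb H1 H2).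
by move=> z bz h1 h2; split=> //; rewrite h1.
Qed.

Lemma cut_open_closed i : @cut_open R n i `<=` @cut_closed R n i.
Proof. by move=> z [bz /andP[/ltW h1 /ltW h2]]; split=> //; rewrite h1. Qed.

Lemma base_nonempty : exists p : 'rV[R]_n, base p.
Proof.
exists (\row_i (i%:R / n%:R)) => i; have ni := ltn_ord i.
have n0 : 0 < n%:R :> R by rewrite ltr0n (leq_ltn_trans _ ni).
rewrite /arc_end !mxE /=; have [h|h] := eqVneq i.+1 n.
  by rewrite h modnn mul0r add0r ltr_pdivrMr // mul1r ltr_nat.
rewrite modn_small ?addr0; last by rewrite ltn_neqAle h.
by rewrite ltr_pM2r ?invr_gt0 // ltr_nat.
Qed.

End BaseOrder.

(** * Fields supported on one arc *)

Section ArcField.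
Variable R : realType.
Implicit Types a b x lam : R.

(** On the line, for [a <= b <= a + 1], a 1-periodic function that is positive
on the arc between [a] and [b] and zero on its complement. *)
Definition bump a b x : R :=
  Num.max 0 (- (sin (pi * (x - a)) * sin (pi * (x - b)))).

(** [sin^4 cot^k] at [pi (x - a)], a polynomial in sine and cosine for [k <= 4];
its even degree makes it 1-periodic. *)
Definition profile a (k : nat) x : R :=
  sin (pi * (x - a)) ^+ (4 - k) * cos (pi * (x - a)) ^+ k.

(** The field [lam f w^k], where [f = bump sin^4] and [w = cot]. *)
Definition arc_field a b lam k x : R := lam * bump a b x * profile a k x.

Lemma sin_pi_ge0 x : 0 <= x <= 1 -> 0 <= sin (pi * x) :> R.
Proof.
move=> /andP[x0 x1]; apply: sin_ge0_pi; rewrite mulr_ge0 ?pi_ge0 //=.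
by rewrite ler_piMr ?pi_ge0.
Qed.

Lemma sin_pi_gt0 x : 0 < x < 1 -> 0 < sin (pi * x) :> R.
Proof.
move=> /andP[x0 x1]; apply: sin_gt0_pi; rewrite mulr_gt0 ?pi_gt0 //=.
by rewrite gtr_pMr ?pi_gt0.
Qed.

Lemma sin_pi_le0 x : -1 <= x <= 0 -> sin (pi * x) <= 0 :> R.
Proof.
move=> h; rewrite -oppr_ge0 -sinN -mulrN; apply: sin_pi_ge0.
by rewrite oppr_ge0 lerNl andbC.
Qed.

Lemma sin_pi_lt0 x : -1 < x < 0 -> sin (pi * x) < 0 :> R.
Proof.
move=> h; rewrite -oppr_gt0 -sinN -mulrN; apply: sin_pi_gt0.
by rewrite oppr_gt0 ltrNl andbC.
Qed.

Lemma sin_piD1 a x : sin (pi * (x + 1 - a)) = - sin (pi * (x - a)) :> R.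
Proof. by rewrite addrAC mulrDr mulr1 sinDpi. Qed.

Lemma cos_piD1 a x : cos (pi * (x + 1 - a)) = - cos (pi * (x - a)) :> R.
Proof. by rewrite addrAC mulrDr mulr1 cosDpi. Qed.

Lemma arc_fieldD1 a b lam k x : (k <= 4)%N ->
  arc_field a b lam k (x + 1) = arc_field a b lam k x.
Proof.
move=> k4; rewrite /arc_field /bump /profile !sin_piD1 cos_piD1 mulrNN.
congr (_ * _).
by rewrite exprNn [(- cos _) ^+ k]exprNn mulrACA -exprD subnK // -signr_odd mul1r.
Qed.

Lemma arc_field_shift a b lam k x : (k <= 4)%N ->
  arc_field (a + 1) (b + 1) lam k x = arc_field a b lam k x.
Proof.
move=> k4; rewrite -(arc_fieldD1 _ _ _ _ k4) /arc_field /bump /profile.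
have subD1 c : x + 1 - (c + 1) = x - c by ring.
by rewrite !subD1.
Qed.

(** The points [x] of the complement of the arc are taken in either of two
lifts, after [b] or before [a]; the two sines have the same sign there. *)
Lemma bump_out a b x : a <= b <= a + 1 ->
  (b <= x <= a + 1) || (b - 1 <= x <= a) -> bump a b x = 0.
Proof.
move=> /andP[ab b1] /orP[]/andP[h1 h2]; apply/max_idPl; rewrite oppr_le0.
  by apply: mulr_ge0; apply: sin_pi_ge0; apply/andP; split; lra.
by apply: mulr_le0; apply: sin_pi_le0; apply/andP; split; lra.
Qed.

Lemma bump_in a b x : b <= a + 1 -> a <= x <= b ->
  bump a b x = - (sin (pi * (x - a)) * sin (pi * (x - b))).
Proof.
move=> b1 /andP[ax xb]; apply/max_idPr; rewrite oppr_ge0.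
by apply: mulr_ge0_le0; [apply: sin_pi_ge0|apply: sin_pi_le0]; apply/andP; split; lra.
Qed.

Lemma arc_field0 a b lam k x : bump a b x = 0 -> arc_field a b lam k x = 0.
Proof. by move=> h; rewrite /arc_field h mulr0 mul0r. Qed.

End ArcField.

Section ArcSection.
Variables (R : realType) (n : nat).

(** The family of fields supported on the [i]-th arc. *)
Definition arc_section (i : 'I_n) (lam : R) (k : nat) (z : R * 'rV[R]_n) : R :=
  arc_field (z.2 ord0 i) (arc_end z.2 i) lam k z.1.

Lemma arc_section_other (i j : 'I_n) lam k z : j != i -> cut_closed j z ->
  arc_section i lam k z = 0.
Proof.
case: z => x p; rewrite neq_ltn => ji [/= bp /andP[jx xj]].
apply: arc_field0 => /=; apply: bump_out; first by rewrite (ltW (bp i)) arc_end_leD1.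
(* The j-th arc lies before p_i or after the end of the i-th arc. *)
case/orP: ji => ji.
  have h1 := arc_end_le bp ji; have h2 := arc_end_leD1 i j bp.
  by apply/orP; right; apply/andP; split; lra.
have h1 := arc_end_le bp ji; have h2 := arc_end_leD1 j i bp.
by apply/orP; left; apply/andP; split; lra.
Qed.

(** The trigonometric polynomial that agrees with [arc_section] on the closed
[i]-th arc. *)
Definition arc_section_trig (i : 'I_n) (lam : R) k (z : R * 'rV[R]_n) : R :=
  - lam * (sin (pi * (z.1 - z.2 ord0 i)) * sin (pi * (z.1 - arc_end z.2 i))) *
  profile (z.2 ord0 i) k z.1.

Lemma arc_section_same (i : 'I_n) lam k z : cut_closed i z ->
  arc_section i lam k z = arc_section_trig i lam k z.
Proof.
case: z => x p [/= bp px]; rewrite /arc_section /arc_field /=.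
by rewrite bump_in ?arc_end_leD1 // mulrN -mulNr.
Qed.

Lemma affine_form_coord (i : 'I_n) (c : R) :
  affine_form (fun z : R * 'rV[R]_n => pi * (z.1 - (z.2 ord0 i + c))).
Proof.
split=> [z|v].
  apply: cvgM; first exact: cvg_cst.
  apply: cvgB; first exact: cvg_fst.
  apply: cvgD; last exact: cvg_cst.
  exact: continuous_comp_snd (@coord_cvg _ _ i) z.
exists (pi * (v.1 - v.2 ord0 i)) => z h /=; rewrite !mxE /GRing.scale /=; ring.
Qed.

Lemma affine_form_start (i : 'I_n) :
  affine_form (fun z : R * 'rV[R]_n => pi * (z.1 - z.2 ord0 i)).
Proof.
have := affine_form_coord i 0.
by congr affine_form; apply/funext => z; rewrite addr0.
Qed.

Lemma trig_poly_profile (i : 'I_n) k :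
  trig_poly (fun z : R * 'rV[R]_n => profile (z.2 ord0 i) k z.1).
Proof.
have l := affine_form_start i.
by apply: trig_mul; apply: trig_poly_exp; [exact: trig_sin l|exact: trig_cos l].
Qed.

Lemma trig_poly_arc_section_trig (i : 'I_n) lam k :
  trig_poly (arc_section_trig i lam k).
Proof.
have s1 := trig_sin (affine_form_start i).
have s2 := trig_sin (affine_form_coord (ordS i) (i.+1 == n)%:R).
have := trig_mul (trig_mul (@trig_cst _ (R * 'rV[R]_n)%type (- lam))
  (trig_mul s1 s2)) (trig_poly_profile i k).
by [].
Qed.

Lemma arc_section_continuous (i : 'I_n) lam k : continuous (arc_section i lam k).
Proof.
move=> z; have pc := trig_poly_continuous (trig_poly_profile i k).
have s1 := trig_sin (affine_form_start i).
have s2 := trig_sin (affine_form_coord (ordS i) (i.+1 == n)%:R).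
have wc := trig_poly_continuous
  (trig_mul (@trig_cst _ (R * 'rV[R]_n)%type (- 1)) (trig_mul s1 s2)).
set w := (X in continuous X) in wc.
have mc : {for z, continuous ((cst 0 : R * 'rV[R]_n -> R) \max w)}.
  by apply: continuous_max; [exact: cst_continuous|exact: wc].
have lc : {for z, continuous (cst lam : R * 'rV[R]_n -> R)} by exact: cst_continuous.
have wE y : w y = - (sin (pi * (y.1 - y.2 ord0 i)) * sin (pi * (y.1 - arc_end y.2 i))).
  exact: mulN1r.
have -> : arc_section i lam k =
    cst lam * (cst 0 \max w) * (fun y => profile (y.2 ord0 i) k y.1).
  by apply/funext => y; rewrite /arc_section /arc_field /bump -(wE y).
exact: continuousM (continuousM lc mc) (pc z).
Qed.

Lemma smooth_arc_section (i : 'I_n) lam k : (k <= 4)%N ->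
  smooth_section (arc_section i lam k).
Proof.
move=> k4; split.
- by move=> x p _; exact: arc_fieldD1.
- by move=> x p _; rewrite /arc_section /= arc_end_shift !mxE arc_field_shift.
- exact/continuous_subspaceT/arc_section_continuous.
- move=> j; have [->|ji] := eqVneq j i.
    apply: (smooth_upto_trig_poly (@cut_open_open _ _ _) (@cut_open_closed _ _ _)
      (trig_poly_arc_section_trig i lam k)).
    by move=> z /set_mem; exact: arc_section_same.
  apply: (smooth_upto_trig_poly (@cut_open_open _ _ _) (@cut_open_closed _ _ _)
    (@trig_cst _ (R * 'rV[R]_n)%type 0)).
  by move=> z /set_mem; exact: arc_section_other.
Qed.

Lemma arc_section_break (i j : 'I_n) lam k p : base p ->
  arc_section i lam k (p ord0 j, p) = 0.
Proof.
move=> bp; have pj : cut_closed j (p ord0 j, p) by split=> //=; rewrite lexx ltW.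
have [ji|ji] := eqVneq j i; last exact: arc_section_other pj.
by rewrite arc_section_same -?ji // /arc_section_trig /= subrr mulr0 sin0; ring.
Qed.

End ArcSection.

(** * Derivatives along the arc *)

Section Line.
Variable R : realType.
Implicit Types (a b x lam : R) (f g : R -> R).

Definition sin_cos_monomial a (m n : nat) x : R :=
  sin (pi * (x - a)) ^+ m * cos (pi * (x - a)) ^+ n.

Lemma profileE a k : profile a k = sin_cos_monomial a (4 - k) k.
Proof. by []. Qed.

Lemma pi_affine a (z h : R) : pi * (h *: 1 + z - a) = h * pi + pi * (z - a) :> R.
Proof. by rewrite /GRing.scale /=; ring. Qed.

Lemma affine_form_pi a : affine_form (fun x : R => pi * (x - a)).
Proof.
split=> [z|v]; last by exists (pi * v) => z h; rewrite /GRing.scale /=; ring.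
by apply: cvgM; [exact: cvg_cst|apply: cvgB; [exact: cvg_id|exact: cvg_cst]].
Qed.

Lemma is_derive_mulf f g x df dg : is_derive x 1 f df -> is_derive x 1 g dg ->
  is_derive x 1 (fun y => f y * g y) (df * g x + f x * dg).
Proof.
move=> fd gd; apply: (is_derive_eq (is_deriveM fd gd)).
by rewrite /GRing.scale /=; ring.
Qed.

Lemma is_derive_expf f m x df : is_derive x 1 f df ->
  is_derive x 1 (fun y => f y ^+ m) (m%:R * f x ^+ m.-1 * df).
Proof.
move=> fd; rewrite (_ : (fun y => f y ^+ m) = f ^+ m); first exact: is_deriveX.
by apply/funext => y; rewrite fctE.
Qed.

(** When an exponent is 0 its truncated predecessor is harmless, since the
coefficient vanishes. *)
Lemma is_derive_sin_cos_monomial a m n x :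
  is_derive x 1 (sin_cos_monomial a m n)
    (pi * (m%:R * sin_cos_monomial a m.-1 n.+1 x -
           n%:R * sin_cos_monomial a m.+1 n.-1 x)).
Proof.
have ds := is_derive_comp_affine (pi_affine a) (is_derive_sin (pi * (x - a))).
have dc := is_derive_comp_affine (pi_affine a) (is_derive_cos (pi * (x - a))).
have := is_derive_mulf (is_derive_expf m ds) (is_derive_expf n dc).
move=> H; apply: (is_derive_eq H); rewrite /sin_cos_monomial /= !exprS; ring.
Qed.

(** The function whose positive part is [bump a b]. *)
Definition sin_product a b x : R := - (sin (pi * (x - a)) * sin (pi * (x - b))).

Lemma trig_poly_sin_product a b : trig_poly (sin_product a b).
Proof.
have := trig_mul (@trig_cst _ R (- 1))
  (trig_mul (trig_sin (affine_form_pi a)) (trig_sin (affine_form_pi b))).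
by congr trig_poly; apply/funext => x; exact: mulN1r.
Qed.

(** The trigonometric polynomial that agrees with [arc_field] where the bump is
positive. *)
Definition smooth_arc_field a b lam k x : R :=
  lam * sin_product a b x * profile a k x.

Lemma trig_poly_smooth_arc_field a b lam k : trig_poly (smooth_arc_field a b lam k).
Proof.
have l := affine_form_pi a.
exact: (trig_mul (trig_mul (@trig_cst _ R lam) (trig_poly_sin_product a b))
  (trig_mul (trig_poly_exp (4 - k) (trig_sin l)) (trig_poly_exp k (trig_cos l)))).
Qed.

Lemma is_derive_smooth_arc_field a b lam k x dq :
  is_derive x 1 (sin_product a b) dq ->
  is_derive x 1 (smooth_arc_field a b lam k)
    (lam * (dq * profile a k x + sin_product a b x *
      (pi * ((4 - k)%:R * sin_cos_monomial a (4 - k).-1 k.+1 x -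
             k%:R * sin_cos_monomial a (4 - k).+1 k.-1 x)))).
Proof.
move=> qd.
have := is_derive_mulf (is_derive_mulf (is_derive_cst lam x 1) qd)
  (is_derive_sin_cos_monomial a (4 - k) k x).
move=> H; apply: (is_derive_eq H); rewrite profileE /cst; ring.
Qed.

Lemma arc_field_near a b lam k x : 0 < bump a b x ->
  \near x, smooth_arc_field a b lam k x = arc_field a b lam k x.
Proof.
rewrite lt_max ltxx /= => q0.
have qc := trig_poly_continuous (trig_poly_sin_product a b).
have H := @cvgr_gt _ _ _ (nbhs_filter _) _ _ (qc x) _ q0.
apply: filterS H => y qy; rewrite /smooth_arc_field /arc_field.
by rewrite /bump (max_idPr (ltW qy)).
Qed.

(** The bracket relation [[f, f w^3] = [3 f w, f w^2]] on the whole line.  Where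
the bump is zero the fields vanish, and their derivatives, which need not exist,
are multiplied by 0. *)
Lemma arc_field_wronskian a b x :
  arc_field a b 1 0 x * derive1 (arc_field a b 1 3) x -
    arc_field a b 1 3 x * derive1 (arc_field a b 1 0) x =
  arc_field a b 3 1 x * derive1 (arc_field a b 1 2) x -
    arc_field a b 1 2 x * derive1 (arc_field a b 3 1) x.
Proof.
have : 0 <= bump a b x by rewrite le_max lexx.
rewrite le_eqVlt => /predU1P[/esym b0|b0].
  by rewrite !arc_field0 // !mul0r.
have [q1 _ qd] := trig_poly_derive (1 : R) (trig_poly_sin_product a b).
have dE lam k := @derive_val _ _ _ _ _ _ _
  (near_eq_is_derive (arc_field_near lam k b0) (is_derive_smooth_arc_field lam k (qd x))).
have fE lam k := nbhs_singleton (arc_field_near lam k b0).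
rewrite !derive1E !dE -!fE /smooth_arc_field !profileE /sin_cos_monomial.
rewrite !(subSS, subn0) /=; ring.
Qed.

Lemma is_derive_unique f x d1 d2 : is_derive x 1 f d1 -> is_derive x 1 f d2 -> d1 = d2.
Proof. by move=> [_ <-] [_ <-]. Qed.

(** First and second derivatives of the fields on the arc, and the pointwise
defect [I(f, f w^3) - I(3 f w, f w^2) = - 6 f^2 w'^3] of the cocycle
integrand. *)
Lemma smooth_arc_field_derivatives a b : exists D1 D2 : R -> nat -> R -> R,
  [/\ forall lam k, continuous (D1 lam k),
      forall lam k, continuous (D2 lam k),
      forall lam k x, is_derive x 1 (smooth_arc_field a b lam k) (D1 lam k x),
      forall lam k x, is_derive x 1 (D1 lam k) (D2 lam k x)
    & forall x,
      (D1 1 0 x * D2 1 3 x - D2 1 0 x * D1 1 3 x) -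
      (D1 3 1 x * D2 1 2 x - D2 3 1 x * D1 1 2 x) =
      6 * pi ^+ 3 * (sin_product a b x * sin (pi * (x - a))) ^+ 2].
Proof.
have [q1 q1T qd] := trig_poly_derive (1 : R) (trig_poly_sin_product a b).
have [q2 q2T q1d] := trig_poly_derive (1 : R) q1T.
have exD lam k : exists D : (R -> R) * (R -> R), [/\ trig_poly D.1, trig_poly D.2,
    forall x, is_derive x 1 (smooth_arc_field a b lam k) (D.1 x)
  & forall x, is_derive x 1 D.1 (D.2 x)].
  have [d1 d1T dd1] := trig_poly_derive (1 : R) (trig_poly_smooth_arc_field a b lam k).
  by have [d2 d2T dd2] := trig_poly_derive (1 : R) d1T; exists (d1, d2).
have /boolp.choice[D DP] : forall w : R * nat, exists D : (R -> R) * (R -> R),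
  [/\ trig_poly D.1, trig_poly D.2,
    forall x, is_derive x 1 (smooth_arc_field a b w.1 w.2) (D.1 x)
  & forall x, is_derive x 1 D.1 (D.2 x)] by move=> w; exact: exD.
exists (fun lam k => (D (lam, k)).1), (fun lam k => (D (lam, k)).2).
split.
- by move=> lam k; have [/trig_poly_continuous] := DP (lam, k).
- by move=> lam k; have [_ /trig_poly_continuous] := DP (lam, k).
- by move=> lam k x; have [_ _] := DP (lam, k); exact.
- by move=> lam k x; have [_ _ _] := DP (lam, k); exact.
move=> x.
pose g k := sin_cos_monomial a (4 - k) k.
pose g1 k x := pi * ((4 - k)%:R * sin_cos_monomial a (4 - k).-1 k.+1 x -
             k%:R * sin_cos_monomial a (4 - k).+1 k.-1 x) : R.
pose g2 k x := pi * ((4 - k)%:R *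
   (pi * ((4 - k).-1%:R * sin_cos_monomial a (4 - k).-2 k.+2 x -
           k.+1%:R * sin_cos_monomial a (4 - k).-1.+1 k x)) -
   k%:R *
   (pi * ((4 - k).+1%:R * sin_cos_monomial a (4 - k) k.-1.+1 x -
           k.-1%:R * sin_cos_monomial a (4 - k).+2 k.-2 x))) : R.
pose q := sin_product a b.
have D1E lam k : (D (lam, k)).1 = fun y => lam * (q1 y * g k y + q y * g1 k y).
  apply/funext => y; have [_ _ /(_ y) h _] := DP (lam, k).
  exact: is_derive_unique h (is_derive_smooth_arc_field lam k (qd y)).
have D2E lam k y : (D (lam, k)).2 y =
    lam * (q2 y * g k y + 2 * q1 y * g1 k y + q y * g2 k y).
  have [_ _ _ /(_ y)] := DP (lam, k); rewrite D1E => h.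
  apply: (is_derive_unique h).
  have m := is_derive_sin_cos_monomial a.
  have gd := m (4 - k)%N k y.
  have g1d : is_derive y 1 (g1 k) (g2 k y).
    have := is_derive_mulf (is_derive_cst (pi : R) y 1)
      (is_deriveB (is_derive_mulf (is_derive_cst ((4 - k)%:R : R) y 1) (m (4 - k).-1 k.+1 y))
        (is_derive_mulf (is_derive_cst (k%:R : R) y 1) (m (4 - k).+1 k.-1 y))).
    by move=> H; apply: (is_derive_eq H); rewrite /g2 /cst /=; ring.
  have := is_derive_mulf (is_derive_cst lam y 1)
    (is_deriveD (is_derive_mulf (q1d y) gd) (is_derive_mulf (qd y) g1d)).
  by move=> H; apply: (is_derive_eq H); rewrite /cst /g1 /g /q; ring.
rewrite !D2E !D1E -/q /g /g1 /g2 /sin_cos_monomial !(subSS, subn0) /=.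
have cs := cos2Dsin2 (pi * (x - a)).
(* Up to the identity sin^2 + cos^2 = 1 the claim is polynomial, for arbitrary
   values of the product of sines and of its first two derivatives. *)
transitivity (6 * pi ^+ 3 * (q x * sin (pi * (x - a))) ^+ 2 *
  (cos (pi * (x - a)) ^+ 2 + sin (pi * (x - a)) ^+ 2) ^+ 3).
  by ring.
by rewrite cs expr1n mulr1.
Qed.

End Line.

(** * Positivity of integrals *)

Section Positivity.
Variable R : realType.
Implicit Types (a b x : R) (f : R -> R).

Lemma continuous_integrable_oo f a b : continuous f ->
  lebesgue_measure.-integrable `]a, b[ (EFin \o f).
Proof.
move=> fc; have := continuous_compact_integrable (@segment_compact R a b) (continuous_subspaceT fc).
apply: integrableS => //; exact: subset_itv_oo_cc.
Qed.

Lemma Rintegral_gt0 f a b : a < b -> continuous f ->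
  (forall x, a < x < b -> 0 < f x) ->
  0 < \int[lebesgue_measure]_(x in `]a, b[) f x.
Proof.
move=> ab fc f0.
have fi := continuous_integrable_oo a b fc.
have ffin : (\int[lebesgue_measure]_(x in `]a, b[) (f x)%:E)%E \is a fin_num.
  by apply: integrable_fin_num fi; exact: measurable_itv.
pose a' := (2 * a + b) / 3; pose b' := (a + 2 * b) / 3.
have [aa' a'b' b'b] : [/\ a < a', a' < b' & b' < b].
  by rewrite /a' /b'; split; lra.
(* On the middle third the function is bounded below by its positive minimum. *)
have [c /[!in_itv] /= /andP[a'c cb'] cmin] := EVT_min (ltW a'b') (continuous_subspaceT fc).
have fc0 : 0 < f c by apply: f0; apply/andP; split; lra.
rewrite /Rintegral fine_gt0 //; apply/andP; split; last first.
  by rewrite ltey_eq ffin.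
apply: (@lt_le_trans _ _ (\int[lebesgue_measure]_(x in `[a', b']) (f c)%:E)%E).
  rewrite integral_cst //= lebesgue_measure_itv /= lte_fin a'b' -EFinB -EFinM lte_fin.
  by rewrite mulr_gt0 // subr_gt0.
have mfo := measurable_int _ fi.
have mfc := measurable_int _
  (continuous_compact_integrable (@segment_compact R a' b') (continuous_subspaceT fc)).
apply: (@le_trans _ _ (\int[lebesgue_measure]_(x in `[a', b']) (f x)%:E)%E).
  by apply: ge0_le_integral => // x _; rewrite lee_fin ltW.
apply: ge0_subset_integral => //.
- by move=> x /= /[!in_itv] /= /andP[h1 h2]; rewrite lee_fin ltW // f0 // h1.
- by move=> x /= /[!in_itv] /= /andP[h1 h2]; apply/andP; split; lra.
Qed.

End Positivity.

(** * Brackets and cocycles of the test sections *)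

Section Final.
Variables (R : realType) (n : nat).
Implicit Types (p : 'rV[R]_n) (i j : 'I_n).

Lemma partial_x_fiber (u : R * 'rV[R]_n -> R) y p :
  partial_x u (y, p) = derive1 (at_fiber u p) y.
Proof.
have quotE : (fun h : R => h^-1 *: ((u \o shift (y, p)) (h *: (1, 0)) - u (y, p))) =
    (fun h : R => h^-1 *: ((at_fiber u p \o shift y) (h *: 1) - at_fiber u p y)).
  apply/funext => h; rewrite /at_fiber /=.
  have -> : h *: ((1, 0) : R * 'rV[R]_n) + (y, p) = (h *: (1 : R) + y, p) => //.
  by apply: injective_projections => //=; rewrite scaler0 add0r.
by rewrite /partial_x derive1E /derive quotE.
Qed.

(** At sections vanishing at the breaks of [p], the terms of the bracket with
derivatives in [p] drop out. *)
Lemma bracket_vertical (u v : R * 'rV[R]_n -> R) p y :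
  (forall i, u (p ord0 i, p) = 0) -> (forall i, v (p ord0 i, p) = 0) ->
  bracket_off_breaks u v (y, p) =
    at_fiber u p y * derive1 (at_fiber v p) y -
    at_fiber v p y * derive1 (at_fiber u p) y.
Proof.
move=> u0 v0; rewrite /bracket_off_breaks !partial_x_fiber big1 ?addr0 // => i _ /=.
by rewrite u0 v0 !mul0r subrr.
Qed.

Lemma anchor_vertical (u : R * 'rV[R]_n -> R) p :
  (forall i, u (p ord0 i, p) = 0) -> anchor u p = 0.
Proof. by move=> u0; apply/rowP => i; rewrite !mxE u0. Qed.

Lemma arc_section_brackets i p : base p ->
  at_fiber (bracket (arc_section i 1 0) (arc_section i 1 3)) p =
  at_fiber (bracket (arc_section i 3 1) (arc_section i 1 2)) p.
Proof.
move=> bp.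
have offE : (fun y => bracket_off_breaks (arc_section i 1 0) (arc_section i 1 3) (y, p)) =
    (fun y => bracket_off_breaks (arc_section i 3 1) (arc_section i 1 2) (y, p)).
  apply/funext => y.
  rewrite !bracket_vertical; try by move=> j; exact: arc_section_break.
  exact: arc_field_wronskian.
by apply/funext => x; rewrite /at_fiber /bracket /= offE.
Qed.

(** The cocycle computed from globally smooth functions that agree with the
fields inside the arc. *)
Lemma arc_cocycle_smooth i p (u v f g f1 g1 f2 g2 : R -> R) :
  {in `]p ord0 i, arc_end p i[, u =1 f} -> {in `]p ord0 i, arc_end p i[, v =1 g} ->
  (forall x : R, is_derive x 1 f (f1 x)) -> (forall x : R, is_derive x 1 g (g1 x)) ->
  (forall x : R, is_derive x 1 f1 (f2 x)) -> (forall x : R, is_derive x 1 g1 (g2 x)) ->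
  arc_cocycle i p u v =
    \int[lebesgue_measure]_(x in `]p ord0 i, arc_end p i[) (f1 x * g2 x - f2 x * g1 x).
Proof.
set I := `]_, _[ => uf vg ff1 gg1 f1f2 g1g2.
have D (w h h' : R -> R) : {in I, w =1 h} -> (forall x : R, is_derive x 1 h (h' x)) ->
    {in I, derive1 w =1 h'}.
  move=> wh hh' x xI; rewrite derive1E; have [_ <-] := hh' x.
  by apply: near_eq_derive; apply: filterS (near_in_itvoo xI) => y; exact: wh.
rewrite /arc_cocycle; apply: eq_Rintegral => x xI.
have {}xI : x \in I by move: xI; rewrite inE.
have d1u := D _ _ _ uf ff1; have d1v := D _ _ _ vg gg1.
by rewrite d1u // d1v // /derive1n /= (D _ _ _ d1u f1f2) // (D _ _ _ d1v g1g2).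
Qed.

Lemma arc_cocycle_other i j k l (lam mu : R) p : base p -> j != i ->
  arc_cocycle j p (at_fiber (arc_section i lam k) p)
    (at_fiber (arc_section i mu l) p) = 0.
Proof.
move=> bp ji.
have z0 c m : {in `]p ord0 j, arc_end p j[, at_fiber (arc_section i c m) p =1 cst 0}.
  move=> x; rewrite in_itv /= => /andP[/ltW h1 /ltW h2].
  by apply: arc_section_other ji _; split=> //=; rewrite h1.
have d0 (x : R) : is_derive x 1 (cst 0 : R -> R) (cst 0 x) by exact: is_derive_cst.
rewrite (arc_cocycle_smooth (z0 lam k) (z0 mu l) d0 d0 d0 d0).
under eq_Rintegral do rewrite /cst mul0r subrr.
by rewrite /Rintegral integral0.
Qed.

Lemma arc_cocycle_same i p : base p ->
  arc_cocycle i p (at_fiber (arc_section i 3 1) p) (at_fiber (arc_section i 1 2) p) <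
  arc_cocycle i p (at_fiber (arc_section i 1 0) p) (at_fiber (arc_section i 1 3) p).
Proof.
move=> bp; set a := p ord0 i; set b := arc_end p i.
have ab : a < b by exact: bp.
have ba : b <= a + 1 by exact: arc_end_leD1.
have [D1 [D2 [c1 c2 d1 d2 D12]]] := smooth_arc_field_derivatives a b.
have z0 c m : {in `]a, b[, at_fiber (arc_section i c m) p =1 smooth_arc_field a b c m}.
  move=> x; rewrite in_itv /= => /andP[/ltW h1 /ltW h2].
  by rewrite /at_fiber /arc_section /arc_field bump_in //= h1.
rewrite (arc_cocycle_smooth (z0 3 1%N) (z0 1 2%N) (d1 _ _) (d1 _ _) (d2 _ _) (d2 _ _)).
rewrite (arc_cocycle_smooth (z0 1 0%N) (z0 1 3%N) (d1 _ _) (d1 _ _) (d2 _ _) (d2 _ _)).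
rewrite -/a -/b; clearbody a b.
have cI lam k mu l :
    continuous (fun x => D1 lam k x * D2 mu l x - D2 lam k x * D1 mu l x).
  move=> x; have m1 := continuousM (c1 lam k x) (c2 mu l x).
  exact: continuousB m1 (continuousM (c2 lam k x) (c1 mu l x)).
rewrite -subr_gt0 -RintegralB //; try exact: continuous_integrable_oo.
apply: Rintegral_gt0 => //.
  by move=> x; exact: continuousB (cI _ _ _ _ x) (cI _ _ _ _ x).
move=> x /andP[ax xb]; rewrite D12.
have s1 : 0 < sin (pi * (x - a)) by apply: sin_pi_gt0; apply/andP; split; lra.
have s2 : sin (pi * (x - b)) < 0 by apply: sin_pi_lt0; apply/andP; split; lra.
have sp : 0 < sin_product a b x by rewrite oppr_gt0 pmulr_rlt0.
apply: mulr_gt0; last exact/exprn_gt0/mulr_gt0.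
by apply: mulr_gt0 => //; exact/exprn_gt0/pi_gt0.
Qed.

End Final.

Theorem proposition5p2 (R : realType) (n : nat) (hn : (1 <= n)%N)
    (c : 'rV[R]_n) (hc : c <> 0) :
  ~ coboundary (fun p u v => \sum_(i < n) c ord0 i * arc_cocycle i p u v).
Proof.
move=> [th _ dth].
have /existsP[i ci] : [exists i, c ord0 i != 0].
  apply/contraT; rewrite negb_exists => /forallP c0; exfalso; apply: hc.
  by apply/rowP => i; rewrite mxE; apply/eqP; have := c0 i; rewrite negbK.
have [p bp] := base_nonempty R n.
have OmegaE lam k mu l : (k <= 4)%N -> (l <= 4)%N ->
    \sum_(j < n) c ord0 j * arc_cocycle j p (at_fiber (arc_section i lam k) p)
      (at_fiber (arc_section i mu l) p) =
    - th p (at_fiber (bracket (arc_section i lam k) (arc_section i mu l)) p).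
  move=> k4 l4; rewrite (dth _ _ (smooth_arc_section i lam k4)
    (smooth_arc_section i mu l4) p bp) /lie_derivative.
  by rewrite !anchor_vertical ?derive0 ?subrr ?sub0r // => j; exact: arc_section_break.
have sumE lam k mu l :
    \sum_(j < n) c ord0 j * arc_cocycle j p (at_fiber (arc_section i lam k) p)
      (at_fiber (arc_section i mu l) p) =
    c ord0 i * arc_cocycle i p (at_fiber (arc_section i lam k) p)
      (at_fiber (arc_section i mu l) p).
  by rewrite (bigD1 i) //= big1 ?addr0 // => j ji; rewrite arc_cocycle_other ?mulr0.
have brE := congr1 (fun w => - th p w) (arc_section_brackets i bp).
have sum_eq := etrans (OmegaE 1 0%N 1 3%N isT isT)
  (etrans brE (esym (OmegaE 3 1%N 1 2%N isT isT))).
have eq_i := mulfI ci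
  (etrans (esym (sumE 1 0%N 1 3%N)) (etrans sum_eq (sumE 3 1%N 1 2%N))).
have /gt_eqF/negbT/eqP := arc_cocycle_same i bp.
by apply.
Qed.
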